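(* Let $(A,\sigma,u,\Lambda)$ be a semiperfect unitary ring, let $(P,[\beta])$ be a quadratic space over it, and let $Q,S$ be summands of $P$. Assume that $(P,[\beta])$ or $(Q,[\beta|_Q])$ is unimodular. Then any isometry $\psi:(Q,[\beta|_Q])\to(S,[\beta|_S])$ extends to an isometry $\varphi\in O(P,[\beta])$.
   Context: Rings are associative and unital. An anti-structure on a ring $A$ is a pair $(\sigma,u)$ where $\sigma:A\to A$, $a\mapsto a^\sigma$, is an anti-automorphism and $u\in A^\times$ satisfies $u^\sigma u=1$ and $a^{\sigma\sigma}=uau^{-1}$ for all $a$. Put $\Lambda^{\min}=\{a-a^\sigma u: a\in A\}$, $\Lambda^{\max}=\{a\in A: a^\sigma u=-a\}$. A form parameter is an additive group $\Lambda$ with $\Lambda^{\min}\subseteq\Lambda\subseteq\Lambda^{\max}$ and $a^\sigma\Lambda a\subseteq\Lambda$ for all $a\in A$; then $(A,\sigma,u,\Lambda)$ is called a unitary ring. It is called semiperfect if $A$ is semiperfect, i.e. $A$ is semilocal and idempotents lift modulo $\mathrm{Jac}(A)$. Let $\mathcal{P}(A)$ be the category of finitely generated projective right $A$-modules. For $P\in\mathcal{P}(A)$, $P^*=\mathrm{Hom}_A(P,A)$ is a right $A$-module via $(fa)(x)=a^\sigma f(x)$. A sesquilinear form on $P$ is a biadditive $\beta:P\times P\to A$ with $\beta(xa,yb)=a^\sigma\beta(x,y)b$; these form an abelian group $\mathcal{S}_P$. $\Lambda_P\subseteq\mathcal{S}_P$ is the subgroup of all $\gamma$ with $\gamma(x,y)=-\gamma(y,x)^\sigma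 u$ and $\gamma(x,x)\in\Lambda$ for all $x,y$. A quadratic space is a pair $(P,[\beta])$ with $P\in\mathcal{P}(A)$ and $[\beta]\in\mathcal{S}_P/\Lambda_P$. Set $h_\beta(x,y)=\beta(x,y)+\beta(y,x)^\sigma u$ (it depends only on $[\beta]$); $(P,[\beta])$ is unimodular if $P\to P^*$, $x\mapsto[y\mapsto h_\beta(x,y)]$, is an isomorphism. An isometry $(P,[\beta])\to(P',[\beta'])$ is an $A$-module isomorphism $\psi$ with $[\beta'(\psi\cdot,\psi\cdot)]=[\beta]$; $O(P,[\beta])$ is the group of isometries of $(P,[\beta])$ to itself. For a submodule $Q\subseteq P$, $\beta|_Q$ is the restriction of $\beta$ to $Q\times Q$. *)

(* Defs.v *)
From HB Require Import structures.
From mathcomp Require Import all_boot all_order all_algebra.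

Set Implicit Arguments.
Unset Strict Implicit.
Unset Printing Implicit Defensive.

Import GRing.Theory.
Local Open Scope ring_scope.

(* Rings are [pzRingType]s, so the zero ring is allowed.  A right A-module is
   an [lmodType A^c], the product x a being [(a : A^c) *: x]; the right module
   A itself is [(A^c)^o].  Multiplication has to be written at type [A], since
   at type [A^c] it is reversed. *)

Section Submodules.

Variables (R : pzRingType) (V : lmodType R).

Definition submod_of (Q : submodClosed V) := {x : V | x \in Q}.

HB.instance Definition _ (Q : submodClosed V) := SubChoice.on (submod_of Q).
HB.instance Definition _ (Q : submodClosed V) :=
  [SubChoice_isSubLmodule of submod_of Q by <:].

Definition is_summand (Q : submodClosed V) : Prop :=
  exists T : submodClosed V,
    (forall x, exists2 y, y \in Q & exists2 z, z \in T & x = y + z)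
    /\ (forall x, x \in Q -> x \in T -> x = 0).

Definition proper_submod (Q : submodClosed V) : Prop := exists x, x \notin Q.

Definition maximal_submod (M : submodClosed V) : Prop :=
  proper_submod M
  /\ forall N : submodClosed V,
       {subset M <= N} -> proper_submod N -> {subset N <= M}.

End Submodules.

Definition semisimple_module (R : pzRingType) (V : lmodType R) : Prop :=
  forall Q : submodClosed V, is_summand Q.

Definition finitely_generated (R : pzRingType) (V : lmodType R) : Prop :=
  exists (n : nat) (g : 'I_n -> V),
    forall x, exists a : 'I_n -> R, x = \sum_(i < n) a i *: g i.

Definition projective (R : pzRingType) (V : lmodType R) : Prop :=
  forall (M N : lmodType R) (p : {linear M -> N}) (f : {linear V -> N}),
    (forall y, exists x, p x = y) ->
    exists g : {linear V -> M}, forall x, p (g x) = f x.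

Section SemiperfectRings.

Variable A : pzRingType.

(* Intersection of the maximal right ideals. *)
Definition in_jacobson (a : A) : Prop :=
  forall M : submodClosed (A^c)^o, maximal_submod M -> a \in M.

Definition semisimple_ring (B : pzRingType) : Prop :=
  semisimple_module ((B^c)^o : lmodType B^c).

(* [B], with the projection [p], is the quotient ring A / Jac(A). *)
Definition semilocal : Prop :=
  exists (B : pzRingType) (p : {rmorphism A -> B}),
    [/\ forall b, exists a, p a = b,
        forall a, p a = 0 <-> in_jacobson a
      & semisimple_ring B].

Definition idempotents_lift : Prop :=
  forall a : A, in_jacobson (a * a - a) ->
    exists2 e : A, e * e = e & in_jacobson (e - a).

Definition semiperfect : Prop := semilocal /\ idempotents_lift.

End SemiperfectRings.

Record unitary_structure (A : pzRingType) := UnitaryStructure {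
  sigma : A -> A;
  uunit : A;
  Lam : zmodClosed A;
  sigma_bij : bijective sigma;
  sigmaD : {morph sigma : a b / a + b};
  sigmaM : forall a b, sigma (a * b) = sigma b * sigma a;
  sigma1 : sigma 1 = 1;
  sigma_uunit : sigma uunit * uunit = 1;
  sigma_sigma : exists v : A,
    [/\ uunit * v = 1, v * uunit = 1
      & forall a, sigma (sigma a) = uunit * a * v];
  Lam_min : forall a, a - sigma a * uunit \in Lam;
  Lam_max : forall a, a \in Lam -> sigma a * uunit = - a;
  Lam_conj : forall a b, b \in Lam -> sigma a * b * a \in Lam
}.

Section QuadraticSpaces.

Variables (A : pzRingType) (U : unitary_structure A).

Local Notation σ := (sigma U).
Local Notation u := (uunit U).

Definition sesquiform (P : lmodType A^c) (beta : P -> P -> A) : Prop :=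
  [/\ forall x x' y, beta (x + x') y = beta x y + beta x' y,
      forall x y y', beta x (y + y') = beta x y + beta x y'
    & forall x y (a b : A),
        beta ((a : A^c) *: x) ((b : A^c) *: y) = σ a * beta x y * b].

Definition in_LambdaP (P : lmodType A^c) (gamma : P -> P -> A) : Prop :=
  [/\ sesquiform gamma,
      forall x y, gamma x y = - (σ (gamma y x) * u)
    & forall x, gamma x x \in Lam U].

(* Elements of S_P / Lambda_P are handled through their representatives:
   this is the equality [beta] = [beta']. *)
Definition same_class (P : lmodType A^c) (beta beta' : P -> P -> A) : Prop :=
  in_LambdaP (fun x y => beta x y - beta' x y).

Definition quadratic_space (P : lmodType A^c) (beta : P -> P -> A) : Prop :=
  [/\ finitely_generated P, projective P & sesquiform beta].

Definition polar (P : lmodType A^c) (beta : P -> P -> A) (x y : P) : A :=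
  beta x y + σ (beta y x) * u.

(* By [polar_sesquiform] below, x |-> polar beta x is a morphism from P to
   the right module P^*, where (f a)(x) = sigma(a) f(x); it is an isomorphism
   when it is injective and surjective. *)
Definition unimodular (P : lmodType A^c) (beta : P -> P -> A) : Prop :=
  (forall x x' : P, polar beta x =1 polar beta x' -> x = x')
  /\ (forall f : {linear P -> (A^c)^o}, exists x : P, polar beta x =1 f).

Definition qisometry (P P' : lmodType A^c) (beta : P -> P -> A)
    (beta' : P' -> P' -> A) (psi : {linear P -> P'}) : Prop :=
  bijective psi /\ same_class (fun x y => beta' (psi x) (psi y)) beta.

Definition restr (P : lmodType A^c) (beta : P -> P -> A)
    (Q : submodClosed P) (x y : submod_of Q) : A := beta (\val x) (\val y).

Lemma polar_sesquiform (P : lmodType A^c) (beta : P -> P -> A) :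
  sesquiform beta -> sesquiform (polar beta).
Proof.
case=> Dl Dr Z; have [v [uv vu ss]] := sigma_sigma U.
rewrite /polar; split=> [x x' y|x y y'|x y a b].
- by rewrite Dl Dr sigmaD mulrDl addrACA.
- by rewrite Dl Dr sigmaD mulrDl addrACA.
- rewrite !Z !sigmaM ss mulrDr mulrDl; congr (_ + _).
  have -> : u * b * v = u * (b * v) by rewrite mulrA.
  by rewrite -!mulrA vu mulr1.
Qed.

End QuadraticSpaces.

Arguments restr {A P} beta Q x y.

(* Main.v *)
Require Import Defs.
From HB Require Import structures.
From mathcomp Require Import all_boot all_order all_algebra.
From mathcomp Require Import boolp classical_sets.

Set Implicit Arguments.
Unset Strict Implicit.
Unset Printing Implicit Defensive.

Import GRing.Theory.
Local Open Scope ring_scope.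

(** Write h for the polarization of beta.  Over a semiperfect ring the summand
    Q is a direct sum of cyclic modules z_i A isomorphic to e_i A with e_i A e_i
    local.  Put w_i = psi z_i.  The isometry phi is built one index at a time
    ([extend_families]): once z_j = w_j for j < k, an isometry fixing these z_j
    and mapping z = z_k to w = w_k is composed with what was found before.

    That isometry is a generalized reflection.  Let M be a projective module,
    y : M -> P a linear map and C a sesquilinear form on M in the class of the
    pullback of beta along y, such that C induces an isomorphism from M to its
    dual; then t |-> t - y (C^-1 (h (y _, t))) is an isometry of P
    ([reflection_isometry]).  It fixes the orthogonal complement of y M.

    The difference y = z - w is orthogonal to the z_j with j < k.  If
    c = h y z is invertible as a map from e A to its dual, then M = e A and
    C = c already move z to w ([swap_by_line]).  If not, c is in
    the radical by locality.  Choose x orthogonal to the z_j such that h x z and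
    h x w are both invertible; such an x exists because over a local ring one of
    two given vectors or their sum avoids both obstructions
    ([common_dual_vector]).  On M = (e A)^* + e A, with y mapping onto the span
    of x and z - w, the form with matrix
        beta x x    h x z
       - h w x        c
    represents the class of beta; its off-diagonal entries are invertible and
    c is not, so it is invertible, and the second column is the one that makes
    the reflection send z to w ([swap_by_plane]).

    Vectors x_i with h x_i z_j = delta_ij e_i, and their analogues for the
    w_i, are all that is asked of beta; each of the two unimodularity
    hypotheses provides them.

    The decomposition of Q comes from a dual basis of P indexed by local
    idempotents, projected to Q, and then orthogonalized
    ([orthogonal_dual_basis]); the local idempotents generate the unit ideal of
    A because a maximal right ideal of A / Jac(A) has a complement generated by
    an idempotent with division corner ([semiperfect_local_unit]). *)

(** * Submodules and Zorn's lemma *)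

Section Submod.
Variables (R : pzRingType) (V : lmodType R).

Lemma submodB (Q : submodClosed V) x y : x \in Q -> y \in Q -> x - y \in Q.
Proof. by move=> Qx Qy; apply: rpredD => //; rewrite -scaleN1r rpredZ. Qed.

Lemma submod_of_prop (S : V -> Prop) :
  S 0 -> (forall x y, S x -> S y -> S (x + y)) ->
  (forall a x, S x -> S (a *: x)) ->
  exists N : submodClosed V, forall x, x \in N <-> S x.
Proof.
move=> S0 SD SZ; pose N : {pred V} := fun x => `[<S x>].
have NP x : x \in N <-> S x by split=> /asboolP.
have Nc : GRing.submod_closed N.
  split=> [|a x y /NP Sx /NP Sy]; apply/NP => //.
  by apply: SD => //; apply: SZ.
pose N' : submodClosed V := HB.pack N (GRing.isSubmodClosed.Build R V N Nc).
by exists N'.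
Qed.

(** Zorn's lemma is applied to the empty set together with the good sets, so
    that the empty chain has an upper bound. *)
Lemma maximal_avoiding (N : submodClosed V) (v : V) :
  v \notin N ->
  exists M : submodClosed V,
    [/\ {subset N <= M}, v \notin M
      & forall M' : submodClosed V, {subset M <= M'} -> v \notin M' ->
          {subset M' <= M}].
Proof.
move=> vN.
pose good (X : set V) := exists M : submodClosed V,
  [/\ {subset N <= M}, v \notin M & forall x, X x <-> x \in M].
have [F PF totF|X [PX maxX]] := @Zorn_bigcup V (fun X => X = set0 \/ good X).
  have [[X0 FX0 gX0]|none] := pselect (exists2 X, F X & good X); last first.
    left; rewrite -classical_sets.subset0 => x [X FX Xx].
    have [X_0|gX] := PF X FX; first by rewrite X_0 in Xx.
    by case: none; exists X.
  right; have [M0 [NM0 vM0 XM0]] := gX0.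
  have memP X x : F X -> X x -> exists M : submodClosed V,
      [/\ v \notin M, forall y, X y <-> y \in M & x \in M].
    move=> FX Xx; have [X_0|[M [_ vM XM]]] := PF X FX; first by rewrite X_0 in Xx.
    by exists M; split=> //; apply/XM.
  have [|||M MP] := @submod_of_prop (\bigcup_(X in F) X)%classic.
  - by exists X0 => //; apply/XM0; rewrite rpred0.
  - move=> x y [X FX Xx] [Y FY Yy].
    have [XY|YX] := totF X Y FX FY.
      have [M [_ MP My]] := memP Y y FY Yy.
      by exists Y => //; apply/MP; rewrite rpredD //; apply/MP/XY.
    have [M [_ MP Mx]] := memP X x FX Xx.
    by exists X => //; apply/MP; rewrite rpredD //; apply/MP/YX.
  - move=> a x [X FX Xx]; have [M [_ MP Mx]] := memP X x FX Xx.
    by exists X => //; apply/MP; rewrite rpredZ.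
  exists M; split=> [x Nx||x]; last exact: iff_sym.
    by apply/MP; exists X0 => //; apply/XM0/NM0.
  apply/negP => /MP[X FX Xv]; have [M' [vM' _]] := memP X v FX Xv.
  by rewrite (negbTE vM').
have [M [NM vM XM]] : good X.
  case: PX => // X_0; exfalso.
  apply: (maxX [set x | x \in N]%classic); last first.
    by right; exists N; split.
  rewrite X_0; split; first by move=> x.
  by move/(_ 0); apply; rewrite /= rpred0.
exists M; split=> // M' MM' vM' x M'x; apply/XM.
apply: contrapT => nXx; apply: (maxX [set x | x \in M']%classic).
  split=> [y /XM /MM' //|]; by move/(_ x M'x).
by right; exists M'; split=> // y /NM /MM'.
Qed.

End Submod.

(** * Corners and local idempotents *)

Section LocalIdempotents.
Variable A : pzRingType.

(** The corner f A e is Hom(e A, f A) for right modules; [corner_unit] singles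
    out the isomorphisms. *)
Definition corner (f e a : A) : Prop := f * a = a /\ a * e = a.

Definition corner_unit (f e a : A) : Prop :=
  exists b, [/\ corner e f b, a * b = f & b * a = e].

(** Locality of the ring e A e, the zero ring being counted as local. *)
Definition local_idempotent (e : A) : Prop :=
  e * e = e
  /\ forall a, corner e e a -> corner_unit e e a \/ corner_unit e e (e - a).

Lemma cornerM (g f e a b : A) :
  corner g f a -> corner f e b -> corner g e (a * b).
Proof. by move=> [ga _] [_ be]; split; rewrite ?mulrA ?ga // -mulrA be. Qed.

Lemma cornerD (f e a b : A) :
  corner f e a -> corner f e b -> corner f e (a + b).
Proof. by move=> [fa ae] [fb be]; split; rewrite ?mulrDr ?mulrDl ?fa ?fb ?ae ?be. Qed.

Lemma cornerN (f e a : A) : corner f e a -> corner f e (- a).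
Proof. by move=> [fa ae]; split; rewrite ?mulrN ?mulNr ?fa ?ae. Qed.

Lemma corner_compress (f e a : A) :
  f * f = f -> e * e = e -> corner f e (f * a * e).
Proof. by move=> ff ee; split; rewrite ?mulrA ?ff // -!mulrA ee. Qed.

Lemma corner_unitN (f e a : A) : corner_unit f e a -> corner_unit f e (- a).
Proof.
by move=> [b [cb ab ba]]; exists (- b); split; rewrite ?mulrNN //; apply: cornerN.
Qed.

(** A split monomorphism e A -> f A with f A indecomposable is an isomorphism,
    unless e A = 0: the idempotent p q of f A f is 0 or f by locality. *)
Lemma local_left_inverse (e f p q : A) :
  local_idempotent f -> (e = 0 -> f = 0) -> e * e = e ->
  corner f e p -> corner e f q -> q * p = e -> p * q = f.
Proof.
move=> [ff lf] e0 ee cp cq qp.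
have idpq : (p * q) * (p * q) = p * q.
  by rewrite mulrA -(mulrA p q p) qp; case: cp => _ ->.
have cpq := cornerM cp cq.
have [[b [_ pqb _]]|[b [_ _ b1]]] := lf _ cpq.
  have : p * q * (p * q * b) = p * q * f by rewrite pqb.
  by rewrite mulrA idpq pqb; case: cpq => _ ->.
have pq0 : p * q = 0.
  have : b * (f - p * q) * (p * q) = f * (p * q) by rewrite b1.
  by rewrite -mulrA mulrBl idpq; case: cpq => -> _; rewrite subrr mulr0.
have e_0 : e = 0 by rewrite -ee -qp -mulrA (mulrA p) pq0 mul0r mulr0.
by rewrite pq0 e0.
Qed.

End LocalIdempotents.

(** * Local idempotents of a semiperfect ring *)

Section Semiperfect.

Local Notation right_ideal B := (submodClosed ((B^c)^o : lmodType B^c)).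

(** Membership in a right ideal of B, for an element typed in B: at the type
    of the regular module, products would be read in the converse ring. *)
Definition in_ideal (B : pzRingType) (I : right_ideal B) (x : B) : Prop :=
  (x : (B^c)^o) \in I.

Lemma in_idealM (B : pzRingType) (I : right_ideal B) (x a : B) :
  in_ideal I x -> in_ideal I (x * a).
Proof. by move=> xI; have := rpredZ (a : B^c) xI. Qed.

Lemma in_idealD (B : pzRingType) (I : right_ideal B) (x y : B) :
  in_ideal I x -> in_ideal I y -> in_ideal I (x + y).
Proof. exact: rpredD. Qed.

Lemma in_idealB (B : pzRingType) (I : right_ideal B) (x y : B) :
  in_ideal I x -> in_ideal I y -> in_ideal I (x - y).
Proof. by move=> xI yI; apply: in_idealD => //; rewrite -mulrN1; apply: in_idealM. Qed.

Lemma right_ideal_of_prop (B : pzRingType) (S : B -> Prop) :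
  S 0 -> (forall x y, S x -> S y -> S (x + y)) ->
  (forall x a, S x -> S (x * a)) ->
  exists I : right_ideal B, forall x, in_ideal I x <-> S x.
Proof.
move=> S0 SD SM.
exact: (@submod_of_prop _ ((B^c)^o : lmodType B^c) S S0 SD (fun a x => SM x a)).
Qed.

Lemma maximal_right_ideal (B : pzRingType) (N : right_ideal B) :
  ~ in_ideal N 1 ->
  exists M : right_ideal B,
    [/\ forall x, in_ideal N x -> in_ideal M x, ~ in_ideal M 1 & maximal_submod M].
Proof.
move=> /negP/maximal_avoiding[M [NM /negP M1 maxM]]; exists M; split=> //.
split; first by exists (1 : B); apply/negP.
move=> M' MM' [x M'x]; apply: maxM => //; apply/negP => M'1; case/negP: M'x.
by have := in_idealM (x : B) (M'1 : in_ideal M' 1); rewrite mul1r.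
Qed.

Variable A : pzRingType.

Lemma jacobson_right_inverse (j : A) :
  in_jacobson j -> exists r : A, (1 - j) * r = 1.
Proof.
move=> Jj; have [|||N NP] := @right_ideal_of_prop A
  (fun x => exists r : A, x = (1 - j) * r).
- by exists 0; rewrite mulr0.
- by move=> x y [r ->] [s ->]; exists (r + s); rewrite mulrDr.
- by move=> x a [r ->]; exists (r * a); rewrite mulrA.
have [/NP[r rE]|N1] := pselect (in_ideal N 1); first by exists r; rewrite -rE.
have [M [NM M1 maxM]] := maximal_right_ideal N1; case: M1.
rewrite -(subrK j 1); apply: in_idealD; last exact: (Jj M maxM).
by apply/NM/NP; exists 1; rewrite mulr1.
Qed.

Section Quotient.
Variables (B : pzRingType) (p : {rmorphism A -> B}).
Hypothesis p_surj : forall b, exists a, p a = b.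
Hypothesis p_ker : forall a, p a = 0 <-> in_jacobson a.

Lemma ker_inverse (j : A) :
  p j = 0 -> exists r : A, (1 - j) * r = 1 /\ r * (1 - j) = 1.
Proof.
move=> pj; have [r jr] := jacobson_right_inverse (proj1 (p_ker j) pj).
have rE : r = 1 - (- (j * r)).
  by rewrite opprK -[X in X + _]jr mulrBl mul1r subrK.
have [|s rs] := @jacobson_right_inverse (- (j * r)).
  by apply/p_ker; rewrite rmorphN rmorphM pj mul0r oppr0.
rewrite -rE in rs; exists r; split=> //.
have -> : 1 - j = s by rewrite -[RHS]mul1r -[in RHS]jr -mulrA rs mulr1.
exact: rs.
Qed.

(** A corner of A inherits units from the corresponding corner of B: an
    element of e + (eAe cap ker p) is a unit of eAe, so inverses lift. *)
Lemma corner_unit_lift (e d : A) :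
  e * e = e -> corner e e d -> corner_unit (p e) (p e) (p d) ->
  corner_unit e e d.
Proof.
move=> ee [ed de] [b' [[b'l b'r] db' b'd]]; have [b0 pb0] := p_surj b'.
pose b := e * b0 * e.
have pb : p b = b' by rewrite !rmorphM pb0 b'l b'r.
have [eb be] : corner e e b by apply: corner_compress.
clearbody b.
have inv c : corner e e c -> p c = p e ->
    exists r, [/\ corner e e r, c * r = e & r * c = e].
  move=> [ec ce] pc; have [|r [jr rj]] := @ker_inverse (e - c).
    by rewrite rmorphB pc subrr.
  have ce' : (1 - (e - c)) * e = c by rewrite !mulrBl mul1r ee ce opprB addrC subrK.
  have ec' : e * (1 - (e - c)) = c by rewrite !mulrBr mulr1 ee ec opprB addrC subrK.
  exists (e * r * e); split; first exact: corner_compress.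
    by rewrite !mulrA ce -{1}ec' -(mulrA e) jr mulr1 ee.
  by rewrite -!mulrA ec -{1}ce' (mulrA r) rj mul1r ee.
have cd : corner e e d by [].
have cb : corner e e b by [].
have pdb : p (d * b) = p e by rewrite rmorphM pb.
have pbd : p (b * d) = p e by rewrite rmorphM pb.
have [r [[er re] dbr _]] := inv _ (cornerM cd cb) pdb.
have [s [[es se] _ sbd]] := inv _ (cornerM cb cd) pbd.
exists (b * r); split; first by apply: (@cornerM _ _ e).
  by rewrite mulrA.
have -> : b * r = s * b.
  by rewrite -[b in RHS]be -dbr !mulrA -(mulrA s) sbd eb.
by rewrite -mulrA.
Qed.

End Quotient.

(** The complement of a maximal right ideal N is a simple right ideal.  It is
    generated by the component c of 1, and the endomorphism ring c B c of a
    simple module is a division ring (Schur); here in the one-sided form, each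
    nonzero d having a right inverse because N + d B = B. *)
Lemma maximal_right_ideal_idempotent (B : pzRingType) (N : right_ideal B) :
  semisimple_ring B -> maximal_submod N ->
  exists c : B, [/\ c * c = c, ~ in_ideal N c
    & forall d, corner c c d -> d = 0 \/ exists2 d', corner c c d' & d * d' = c].
Proof.
move=> ssB [[w Nw] maxN]; have [C [NC disj]] := ssB N.
have {NC} [n [c [Nn Cc n1c]]] : exists n c : B,
    [/\ in_ideal N n, in_ideal C c & 1 = n + c].
  by have [n Nn [c Cc n1c]] := NC (1 : B); exists n, c.
have {}disj (x : B) : in_ideal N x -> in_ideal C x -> x = 0 by apply: disj.
have cN x : in_ideal N x -> c * x = 0.
  move=> Nx; apply: disj; last exact: in_idealM.
  have -> : c * x = x - n * x by rewrite -[X in X - _]mul1r n1c mulrDl addrC addKr.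
  by apply: in_idealB => //; apply: in_idealM.
have cc : c * c = c.
  have nc : n * c = 0.
    apply: disj; first exact: in_idealM.
    have -> : n * c = c - c * c by rewrite -[X in X - _]mul1r n1c mulrDl addrK.
    by apply: in_idealB => //; apply: in_idealM.
  by rewrite -[RHS]mul1r n1c mulrDl nc add0r.
exists c; split=> //.
  move=> Nc; case/negP: Nw; rewrite -/(in_ideal N w) -[w](@mul1r B) n1c.
  by apply: in_idealM; apply: in_idealD.
move=> d [cd dc].
have [Nd|Nd] := pselect (in_ideal N d); first by left; rewrite -cd cN.
right; have [|||M MP] := @right_ideal_of_prop B
  (fun x => exists2 y, in_ideal N y & exists z : B, x = y + d * z).
- by exists 0; [exact: rpred0|exists 0; rewrite mulr0 addr0].
- move=> x y [x1 Nx1 [x2 ->]] [y1 Ny1 [y2 ->]]; exists (x1 + y1); first exact: in_idealD.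
  by exists (x2 + y2); rewrite mulrDr addrACA.
- move=> x a [x1 Nx1 [x2 ->]]; exists (x1 * a); first exact: in_idealM.
  by exists (x2 * a); rewrite mulrA -mulrDl.
have [/MP[y Ny [z cE]]|Mc] := pselect (in_ideal M c).
  have cdz : d * z = c by rewrite -{1}cd -[LHS]add0r -(cN y Ny) -mulrA -mulrDr -cE cc.
  exists (c * z * c); first exact: corner_compress.
  by rewrite !mulrA dc cdz.
case: Nd; apply: (maxN M).
- by move=> x Nx; apply/MP; exists x => //; exists 0; rewrite mulr0 addr0.
- by exists c; apply/negP.
- by apply/MP; exists 0; [exact: rpred0|exists 1; rewrite mulr1 add0r].
Qed.

Lemma division_corner_two_sided (B : pzRingType) (c : B) :
  (forall d, corner c c d -> d = 0 \/ exists2 d', corner c c d' & d * d' = c) ->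
  forall d, corner c c d -> d = 0 \/ corner_unit c c d.
Proof.
move=> divc d cd; have [->|[d' cd' dd']] := divc d cd; [by left|right].
have [d'0|[d'' [cd''l cd''r] d'd'']] := divc d' cd'.
  have c0 : c = 0 by rewrite -dd' d'0 mulr0.
  by exists d'; split=> //; rewrite c0 d'0 mul0r.
exists d'; split=> //; suff <- : d'' = d by [].
by rewrite -cd''l -dd' -mulrA d'd''; case: cd.
Qed.

(** Let T be the two-sided ideal generated by the local idempotents.  If the
    image of T in B = A / Jac(A) were proper, it would lie in a maximal right
    ideal, whose complement is generated by an idempotent c with c B c a
    division ring.  A lift e of c is local, so c lies in the image of T and
    hence in that maximal ideal, which is absurd.  Thus T contains some
    1 - j with j in Jac(A), and this is a unit. *)
Lemma semiperfect_local_unit : semiperfect A ->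
  exists (n : nat) (a e b : 'I_n -> A),
    (forall i, local_idempotent (e i)) /\ 1 = \sum_i a i * e i * b i.
Proof.
move=> [[B [p [p_surj p_ker ssB]]] lift].
pose T (x : A) := exists (n : nat) (a e b : 'I_n -> A),
    (forall i, local_idempotent (e i)) /\ x = \sum_i a i * e i * b i.
have TM x a : T x -> T (x * a).
  move=> [n [a1 [e [b [le ->]]]]]; exists n, a1, e, (fun i => b i * a); split=> //.
  by rewrite mulr_suml; apply: eq_bigr => i _; rewrite !mulrA.
have T0 : T 0.
  have z : 'I_0 -> A by case.
  by exists 0, z, z, z; split; [case|rewrite big_ord0].
have TD x y : T x -> T y -> T (x + y).
  move=> [n [a1 [e1 [b1 [l1 ->]]]]] [m [a2 [e2 [b2 [l2 ->]]]]].
  pose j (f1 : 'I_n -> A) (f2 : 'I_m -> A) i :=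
    match split i with inl k => f1 k | inr k => f2 k end.
  exists (n + m)%N, (j a1 a2), (j e1 e2), (j b1 b2); split.
    by move=> i; rewrite /j; case: split.
  rewrite big_split_ord; congr (_ + _); apply: eq_bigr => i _; rewrite /j.
    by rewrite (unsplitK (inl i)).
  by rewrite (unsplitK (inr i)).
have [|||N NP] := @right_ideal_of_prop B (fun y => exists2 x, T x & y = p x).
- by exists 0; rewrite ?rmorph0.
- by move=> x y [x' Tx ->] [y' Ty ->]; exists (x' + y'); [exact: TD|rewrite rmorphD].
- move=> _ b [x Tx ->]; have [a <-] := p_surj b.
  by exists (x * a); [exact: TM|rewrite rmorphM].
have [/NP[t Tt pt]|N1] := pselect (in_ideal N 1).
  have [|r [tr _]] := @ker_inverse B p p_ker (1 - t).
    by rewrite rmorphB rmorph1 -pt subrr.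
  by rewrite subKr in tr; have := TM _ r Tt; rewrite tr.
exfalso; have [M [NM _ maxM]] := maximal_right_ideal N1.
have [c [cc Mc divc]] := maximal_right_ideal_idempotent ssB maxM.
have [a pa] := p_surj c.
have [|e ee Jea] := lift a; first by apply/p_ker; rewrite rmorphB rmorphM pa cc subrr.
have pe : p e = c.
  by apply/eqP; rewrite -pa -subr_eq0 -rmorphB; apply/eqP/p_ker.
apply: Mc; apply/NM/NP; exists e => //.
exists 1, (fun _ => 1), (fun _ => e), (fun _ => 1); split; last first.
  by rewrite big_ord1 mul1r mulr1.
move=> _; split=> // d cd; have [ed de] := cd.
have [|pd|pd] := @division_corner_two_sided B c divc (p d).
- by rewrite -pe; split; rewrite -rmorphM ?ed ?de.
- right; apply: (corner_unit_lift p_surj p_ker) => //.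
    by apply: cornerD; [by []|exact: cornerN].
  rewrite rmorphB pd subr0; exists (p e).
  by split; try split; rewrite -rmorphM ee.
- by left; apply: (corner_unit_lift p_surj p_ker) => //; rewrite pe.
Qed.

End Semiperfect.

(** * Orthogonal dual bases *)

Section RightModules.
Variables (A : pzRingType) (P : lmodType A^c).

(** Right multiplication with the scalar kept in A, so that products of scalars
    are taken in A and not in the converse ring. *)
Definition rscale (x : P) (a : A) : P := (a : A^c) *: x.
Local Infix "∙" := rscale (at level 40, left associativity).

Lemma rscaleA x a b : x ∙ a ∙ b = x ∙ (a * b).
Proof. by rewrite /rscale scalerA. Qed.
Lemma rscaleDl x y a : (x + y) ∙ a = x ∙ a + y ∙ a.
Proof. by rewrite /rscale scalerDr. Qed.
Lemma rscaleDr x a b : x ∙ (a + b) = x ∙ a + x ∙ b.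
Proof. by rewrite /rscale scalerDl. Qed.
Lemma rscale0r x : x ∙ 0 = 0. Proof. exact: scale0r. Qed.
Lemma rscaleNl x a : (- x) ∙ a = - (x ∙ a).
Proof. by rewrite /rscale scalerN. Qed.
Lemma rscaleNr x a : x ∙ (- a) = - (x ∙ a).
Proof. by rewrite /rscale -scaleNr. Qed.
Lemma rscale_suml n (x : 'I_n -> P) a : (\sum_i x i) ∙ a = \sum_i x i ∙ a.
Proof. by rewrite /rscale scaler_sumr. Qed.
Lemma rscale_sumr n x (a : 'I_n -> A) : x ∙ (\sum_i a i) = \sum_i x ∙ a i.
Proof. by elim/big_rec2: _ => [|i y b _ <-]; rewrite ?rscale0r ?rscaleDr. Qed.

Definition functional (f : P -> A) : Prop :=
  (forall x y, f (x + y) = f x + f y) /\ (forall x a, f (x ∙ a) = f x * a).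

Section FunctionalTheory.
Variables (f : P -> A) (hf : functional f).

Lemma functional0 : f 0 = 0.
Proof. by rewrite -(rscale0r 0) (proj2 hf) mulr0. Qed.
Lemma functionalN x : f (- x) = - f x.
Proof. by apply/eqP; rewrite -addr_eq0 -(proj1 hf) addNr functional0. Qed.
Lemma functionalB x y : f (x - y) = f x - f y.
Proof. by rewrite (proj1 hf) functionalN. Qed.
Lemma functional_sum n (x : 'I_n -> P) : f (\sum_i x i) = \sum_i f (x i).
Proof. by elim/big_rec2: _ => [|i a y _ <-]; rewrite ?functional0 ?(proj1 hf). Qed.

End FunctionalTheory.

Definition fcons (T : Type) n (t : T) (s : 'I_n -> T) (i : 'I_n.+1) : T :=
  if unlift ord0 i is Some j then s j else t.

Lemma fcons0 T n (t : T) (s : 'I_n -> T) : fcons t s ord0 = t.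
Proof. by rewrite /fcons unlift_none. Qed.
Lemma fconsS T n (t : T) (s : 'I_n -> T) j : fcons t s (lift ord0 j) = s j.
Proof. by rewrite /fcons liftK. Qed.

(** Each x_i is a map e_i A -> P and each f_i a map P -> e_i A. *)
Definition dual_family n (e : 'I_n -> A) (x : 'I_n -> P) (f : 'I_n -> P -> A) :=
  forall i, [/\ local_idempotent (e i), x i ∙ e i = x i, functional (f i)
    & forall t, e i * f i t = f i t].

Lemma dual_family_linear n (x : 'I_n -> P) (f : 'I_n -> P -> A) (pi : P -> P) :
  (forall i, functional (f i)) -> (forall t, pi t = \sum_i x i ∙ f i t) ->
  (forall s t, pi (s + t) = pi s + pi t) /\ (forall t a, pi (t ∙ a) = pi t ∙ a).
Proof.
move=> hf pE; split=> [s t|t a]; rewrite !pE.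
  by rewrite -big_split; apply: eq_bigr => i _; rewrite (proj1 (hf i)) rscaleDr.
by rewrite rscale_suml; apply: eq_bigr => i _; rewrite (proj2 (hf i)) rscaleA.
Qed.

Definition orthogonal_family n (e : 'I_n -> A) (z : 'I_n -> P)
    (g : 'I_n -> P -> A) :=
  forall i j, g i (z j) = if i == j then e i else 0.

Lemma orthogonal_fix n e (z : 'I_n -> P) g (pi : P -> P) :
  dual_family e z g -> orthogonal_family e z g ->
  (forall t, pi t = \sum_i z i ∙ g i t) ->
  (forall j, pi (z j) = z j) /\ (forall i t, g i (pi t) = g i t).
Proof.
move=> dual orth pE; split=> [j|i t]; rewrite pE.
  rewrite (bigD1 j) //= orth eqxx big1 => [|i ij].
    by rewrite addr0; case: (dual j).
  by rewrite orth (negbTE ij) rscale0r.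
have [_ _ gi eg] := dual i; rewrite (functional_sum gi) (bigD1 i) //=.
rewrite (proj2 gi) orth eqxx eg big1 ?addr0 // => j ji.
by rewrite (proj2 gi) orth eq_sym (negbTE ji) mul0r.
Qed.

(** A retract Q = pi P of a direct sum of modules e_i A with local endomorphism
    rings is itself such a direct sum.  By induction on the number of terms:
    consider a = f_0 x_0 in the local ring e_0 A e_0.  If a is a unit, x_0
    generates a direct summand of Q isomorphic to e_0 A, with complement the
    kernel of f_0 in Q, on which the other terms form a dual basis.  If
    e_0 - a is a unit, the expansion of x_0 can be solved for x_0, which
    expresses it through the other x_i and makes the first term superfluous. *)
Lemma orthogonal_dual_basis N (e : 'I_N -> A) (x : 'I_N -> P)
    (f : 'I_N -> P -> A) (pi : P -> P) :
  dual_family e x f -> (forall t, pi t = \sum_i x i ∙ f i t) ->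
  (forall i, pi (x i) = x i) -> (forall i t, f i (pi t) = f i t) ->
  exists n (e' : 'I_n -> A) (z : 'I_n -> P) (g : 'I_n -> P -> A),
    [/\ dual_family e' z g, orthogonal_family e' z g
      & forall t, pi t = \sum_i z i ∙ g i t].
Proof.
elim: N e x f pi => [|N IH] e x f pi dual piE pix fpi.
  by exists 0, e, x, f; split=> // -[].
have f_fun i : functional (f i) by case: (dual i).
have [piD piZ] := dual_family_linear f_fun piE.
have pi0 : pi 0 = 0 by rewrite -[X in pi X](rscale0r 0) piZ rscale0r.
have piN t : pi (- t) = - pi t.
  by apply/eqP; rewrite -addr_eq0 -piD addNr pi0.
have pipi t : pi (pi t) = pi t.
  by rewrite [LHS]piE [RHS]piE; apply: eq_bigr => i _; rewrite fpi.
have [[ee le] xe hf ef] := dual ord0.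
set e0 := e ord0 in ee le xe ef; set x0 := x ord0 in xe.
set f0 := f ord0 in hf ef; pose a := f0 x0.
have fpi0 t : f0 (pi t) = f0 t := fpi ord0 t.
have pix0 : pi x0 = x0 := pix ord0.
have ca : corner e0 e0 a by split; rewrite /a ?ef // -(proj2 hf) xe.
have [[b [cb ab ba]]|[d [cd dl dr]]] := le a ca.
  pose y0 := x0 ∙ b; pose pi' t := pi t - y0 ∙ f0 t.
  have pi'_def t : pi' t = pi t - y0 ∙ f0 t by [].
  clearbody pi'.
  have fy : f0 y0 = e0 by rewrite (proj2 hf).
  have piy : pi y0 = y0 by rewrite piZ pix0.
  have pi'D s t : pi' (s + t) = pi' s + pi' t.
    by rewrite !pi'_def piD (proj1 hf) rscaleDr opprD addrACA.
  have pi'Z t c : pi' (t ∙ c) = pi' t ∙ c.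
    by rewrite !pi'_def piZ (proj2 hf) rscaleDl rscaleNl rscaleA.
  have f0pi' t : f0 (pi' t) = 0.
    by rewrite pi'_def (functionalB hf) fpi0 (proj2 hf) fy ef subrr.
  have pipi' t : pi (pi' t) = pi' t by rewrite pi'_def piD piN piZ piy pipi.
  have pi'pi' t : pi' (pi' t) = pi' t.
    by rewrite {1}pi'_def pipi' f0pi' rscale0r subr0.
  have pi'E t : pi' t = \sum_i pi' (x (lift ord0 i)) ∙ f (lift ord0 i) (pi' t).
    rewrite -[LHS]pi'pi' -[X in pi' X]pipi' piE big_ord_recl -/f0 f0pi' rscale0r add0r.
    elim/big_rec2: _ => [|i u v _ <-]; last by rewrite pi'D pi'Z.
    by rewrite -[X in pi' X](rscale0r 0) pi'Z rscale0r.
  have [||||n [e' [z [g [dual' orth' pi'E']]]]] :=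
    IH (fun i => e (lift ord0 i)) (fun i => pi' (x (lift ord0 i)))
       (fun i t => f (lift ord0 i) (pi' t)) pi'.
  - move=> i; have [le1 xe1 [fD fZ] ef1] := dual (lift ord0 i).
    split=> // [|]; first by rewrite -pi'Z xe1.
    by split=> [s t|t c]; rewrite /= ?pi'D ?pi'Z ?fD ?fZ.
  - exact: pi'E.
  - by move=> i; apply: pi'pi'.
  - by move=> i t; rewrite pi'pi'.
  have [pi'z gpi'] := orthogonal_fix dual' orth' pi'E'.
  have pi'y : pi' y0 = 0.
    by rewrite pi'_def piy fy /y0 rscaleA; case: cb => _ ->; rewrite subrr.
  exists n.+1, (fcons e0 e'), (fcons y0 z), (fcons f0 g); split.
  - move=> i; case: (unliftP ord0 i) => [j|] ->; rewrite ?fconsS ?fcons0 //.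
    by split=> //; rewrite rscaleA; case: cb => _ ->.
  - move=> i j; case: (unliftP ord0 i) => [i'|] ->; case: (unliftP ord0 j) => [j'|] ->;
      rewrite ?fconsS ?fcons0 ?eqxx //.
    + have [_ _ gi _] := dual' i'.
      by rewrite -gpi' pi'y (functional0 gi).
    + by rewrite -pi'z f0pi'.
  - move=> t; rewrite big_ord_recl !fcons0.
    under eq_bigr do rewrite !fconsS.
    by rewrite -pi'E' pi'_def addrC subrK.
have xE : x0 = \sum_i x (lift ord0 i) ∙ (f (lift ord0 i) x0 * d).
  rewrite -[LHS]xe -dl -rscaleA rscaleDr rscaleNr xe -[X in X - _]pix0.
  rewrite piE big_ord_recl addrC addrA addNr add0r rscale_suml.
  by apply: eq_bigr => i _; rewrite rscaleA.
apply: (IH (fun i => e (lift ord0 i)) (fun i => x (lift ord0 i))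
  (fun i t => f (lift ord0 i) t + f (lift ord0 i) x0 * d * f0 t) pi).
- move=> i; have [le1 xe1 [fD fZ] ef1] := dual (lift ord0 i).
  split=> // [|t]; last by rewrite mulrDr !mulrA ef1 ef1.
  split=> [s t|t c].
    by rewrite fD (proj1 hf) mulrDr addrACA.
  by rewrite fZ (proj2 hf) mulrDl !mulrA.
- move=> t; rewrite piE big_ord_recl -/x0 -/f0 {1}xE rscale_suml -big_split /=.
  by apply: eq_bigr => i _; rewrite rscaleDr addrC rscaleA.
- by move=> i; apply: pix.
- by move=> i t; rewrite fpi fpi0.
Qed.

End RightModules.

(** * Forms and generalized reflections *)

Section Forms.
Variables (A : pzRingType) (U : unitary_structure A).

Local Infix "∙" := rscale (at level 40, left associativity).
Local Notation σ := (sigma U).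
Local Notation u := (uunit U).
Local Notation v := (sigma U (uunit U)).

Lemma mulvu : v * u = 1. Proof. exact: sigma_uunit. Qed.

Lemma muluv : u * v = 1.
Proof.
have [w [uw _ _]] := sigma_sigma U.
by rewrite -[v]mulr1 -[X in v * X]uw (mulrA v) mulvu mul1r.
Qed.

Lemma sigma_sigmaE a : σ (σ a) = u * a * v.
Proof.
have [w [uw _ ->]] := sigma_sigma U.
by rewrite -[v]mulr1 -uw (mulrA v) mulvu mul1r.
Qed.

Lemma sigma0 : σ 0 = 0.
Proof. by apply: (addrI (σ 0)); rewrite -sigmaD !addr0. Qed.
Lemma sigmaN a : σ (- a) = - σ a.
Proof. by apply/eqP; rewrite -addr_eq0 -sigmaD addNr sigma0. Qed.
Lemma sigmaB a b : σ (a - b) = σ a - σ b.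
Proof. by rewrite sigmaD sigmaN. Qed.
Lemma sigma_sum n (a : 'I_n -> A) : σ (\sum_i a i) = \sum_i σ (a i).
Proof. by elim/big_rec2: _ => [|i x y _ <-]; rewrite ?sigma0 ?sigmaD. Qed.

(** Off the diagonal, X i j + X j i has the shape a - a^sigma u and so lies
    in the minimal form parameter. *)
Lemma Lam_skew_sum n (X : 'I_n -> 'I_n -> A) :
  (forall i, X i i \in Lam U) -> (forall i j, X i j = - (σ (X j i) * u)) ->
  \sum_i \sum_j X i j \in Lam U.
Proof.
elim: n X => [|n IH] X Xd Xs; first by rewrite big_ord0 rpred0.
rewrite big_ord_recl.
under [X in _ + X]eq_bigr do rewrite big_ord_recl.
rewrite big_split big_ord_recl /= !addrA -[X in X + _]addrA -big_split /=.
apply: rpredD; last by apply: IH.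
apply: rpredD => //; apply: rpred_sum => i _.
by rewrite [X in _ + X]Xs; apply: Lam_min.
Qed.

Definition adj m n (X : 'M[A]_(m, n)) : 'M[A]_(n, m) := \matrix_(i, j) σ (X j i).

Lemma adjM m n p (X : 'M[A]_(m, n)) (Y : 'M[A]_(n, p)) :
  adj (X *m Y) = adj Y *m adj X.
Proof.
apply/matrixP=> i j; rewrite !mxE sigma_sum.
by apply: eq_bigr => k _; rewrite !mxE sigmaM.
Qed.

Lemma adjK m n (X : 'M[A]_(m, n)) : adj (adj X) = u%:M *m X *m v%:M.
Proof.
apply/matrixP=> i j; rewrite !mxE (bigD1 j) //= big1 => [|k kj].
  rewrite !mxE eqxx mulr1n addr0 (bigD1 i) //= big1 => [|k ki].
    by rewrite !mxE eqxx mulr1n addr0 sigma_sigmaE.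
  by rewrite !mxE eq_sym (negbTE ki) mul0r.
by rewrite !mxE (negbTE kj) mulr0.
Qed.

Lemma mul_vu_mx n : v%:M *m u%:M = 1%:M :> 'M[A]_n.
Proof. by rewrite -scalar_mxM mulvu. Qed.
Lemma mul_uv_mx n : u%:M *m v%:M = 1%:M :> 'M[A]_n.
Proof. by rewrite -scalar_mxM muluv. Qed.

Lemma col_mul_scalar n (r : 'cV[A]_n) (a : A) i : (r *m a%:M) i 0 = r i 0 * a.
Proof. by rewrite mxE big_ord1 [a%:M 0 0]mxE eqxx mulr1n. Qed.

Variables (P : lmodType A^c) (beta : P -> P -> A).
Hypothesis beta_sesqui : sesquiform U beta.

Section SesquiTheory.
Variables (b : P -> P -> A) (hb : sesquiform U b).

Lemma sesquiDl x x' y : b (x + x') y = b x y + b x' y. Proof. by case: hb. Qed.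
Lemma sesquiDr x y y' : b x (y + y') = b x y + b x y'. Proof. by case: hb. Qed.
Lemma sesquiZl x y a : b (x ∙ a) y = σ a * b x y.
Proof. by case: hb => _ _ /(_ x y a 1); rewrite scale1r mulr1. Qed.
Lemma sesquiZr x y a : b x (y ∙ a) = b x y * a.
Proof. by case: hb => _ _ /(_ x y 1 a); rewrite scale1r sigma1 mul1r. Qed.
Lemma sesqui0l y : b 0 y = 0.
Proof. by rewrite -[X in b X y](rscale0r 0) sesquiZl sigma0 mul0r. Qed.
Lemma sesqui0r x : b x 0 = 0.
Proof. by rewrite -[X in b x X](rscale0r 0) sesquiZr mulr0. Qed.
Lemma sesquiNl x y : b (- x) y = - b x y.
Proof. by apply/eqP; rewrite -addr_eq0 -sesquiDl addNr sesqui0l. Qed.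
Lemma sesquiNr x y : b x (- y) = - b x y.
Proof. by apply/eqP; rewrite -addr_eq0 -sesquiDr addNr sesqui0r. Qed.
Lemma sesquiBl x x' y : b (x - x') y = b x y - b x' y.
Proof. by rewrite sesquiDl sesquiNl. Qed.
Lemma sesquiBr x y y' : b x (y - y') = b x y - b x y'.
Proof. by rewrite sesquiDr sesquiNr. Qed.

Lemma sesqui_suml n (x : 'I_n -> P) y : b (\sum_i x i) y = \sum_i b (x i) y.
Proof. by elim/big_rec2: _ => [|i a z _ <-]; rewrite ?sesqui0l ?sesquiDl. Qed.
Lemma sesqui_sumr n x (y : 'I_n -> P) : b x (\sum_i y i) = \sum_i b x (y i).
Proof. by elim/big_rec2: _ => [|i a z _ <-]; rewrite ?sesqui0r ?sesquiDr. Qed.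

End SesquiTheory.

Local Notation h := (polar U beta).
Let h_sesqui : sesquiform U h := polar_sesquiform beta_sesqui.

Lemma polar_sym x y : h x y = σ (h y x) * u.
Proof.
rewrite /polar sigmaD sigmaM sigma_sigmaE mulrDl -!mulrA mulvu mulr1.
by rewrite (mulrA v) mulvu mul1r addrC.
Qed.

(** The two invariants of a class [beta]: its polarization and its quadratic
    map x |-> beta x x mod Lambda.  Preserving the class amounts to preserving
    both, and they are easier to compute with than representatives. *)
Definition preserves_form (phi : P -> P) : Prop :=
  (forall s t, h (phi s) (phi t) = h s t)
  /\ (forall t, beta (phi t) (phi t) - beta t t \in Lam U).

Lemma preserves_form_qisometry (phi : {linear P -> P}) :
  bijective phi -> preserves_form phi -> qisometry U beta beta phi.
Proof.
move=> bij [Hh Hd]; split=> //; split=> //.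
  split=> [x x' y|x y y'|x y a b].
  - by rewrite linearD !(sesquiDl beta_sesqui) opprD addrACA.
  - by rewrite linearD !(sesquiDr beta_sesqui) opprD addrACA.
  - have [_ _ Z] := beta_sesqui.
    by rewrite !linearZ !Z -mulrBl -mulrBr.
move=> x y; apply/eqP; rewrite -addr_eq0 sigmaB mulrBl addrACA -opprD subr_eq0.
by apply/eqP/Hh.
Qed.

Definition lincomb n (y : 'I_n -> P) (r : 'cV[A]_n) : P := \sum_i y i ∙ r i 0.
Definition pairing n (y : 'I_n -> P) (t : P) : 'cV[A]_n := \col_i h (y i) t.

(** The module M is E A^n, the direct sum of the e_i A when E is diagonal with
    entries e_i; D is the inverse of C between M and its dual, on which adj E is
    the identity.  [polarC] and [LamC] say that C represents the class
    of the pullback of beta along y. *)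
Section Reflection.
Variables (n : nat) (y : 'I_n -> P) (C D E : 'M[A]_n).
Hypothesis polarC : forall i j, h (y i) (y j) = C i j + σ (C j i) * u.
Hypothesis LamC : forall i, beta (y i) (y i) - C i i \in Lam U.
Hypotheses (DC : D *m C = E) (CD : C *m D = adj E) (ED : E *m D = D).
Hypothesis adjE_pairing : forall t, adj E *m pairing y t = pairing y t.

Local Notation Ct := (adj C *m u%:M).
Local Notation Dt := (v%:M *m adj D).
Local Notation H := (pairing y).

Lemma lincombB r s : lincomb y (r - s) = lincomb y r - lincomb y s.
Proof.
rewrite /lincomb -sumrB; apply: eq_bigr => i _.
by rewrite !mxE rscaleDr rscaleNr.
Qed.
Lemma lincombD r s : lincomb y (r + s) = lincomb y r + lincomb y s.
Proof.
rewrite /lincomb -big_split; apply: eq_bigr => i _.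
by rewrite !mxE rscaleDr.
Qed.

Lemma pairingB s t : H (s - t) = H s - H t.
Proof. by apply/colP=> i; rewrite !mxE sesquiBr. Qed.
Lemma pairingD s t : H (s + t) = H s + H t.
Proof. by apply/colP=> i; rewrite !mxE sesquiDr. Qed.

(** The Gram matrix of h on the y_i is the polarization of C. *)
Lemma pairing_lincomb r : H (lincomb y r) = (C + Ct) *m r.
Proof.
apply/colP=> i; rewrite !mxE sesqui_sumr //; apply: eq_bigr => j _.
rewrite sesquiZr // polarC !mxE (bigD1 j) //= big1 => [|k kj]; last first.
  by rewrite !mxE (negbTE kj) mulr0.
by rewrite !mxE eqxx mulr1n addr0.
Qed.

Lemma polar_lincombl r t : (h (lincomb y r) t)%:M = adj r *m H t.
Proof.
apply/matrixP=> i j; rewrite !ord1 !mxE eqxx mulr1n sesqui_suml //.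
by apply: eq_bigr => k _; rewrite !mxE sesquiZl.
Qed.

Lemma polar_lincombr r t : (h t (lincomb y r))%:M = adj (H t) *m u%:M *m r.
Proof.
have su : adj (u%:M : 'M[A]_1) = v%:M.
  by apply/matrixP=> i j; rewrite !ord1 !mxE.
rewrite polar_sym scalar_mxM.
have -> : (σ (h (lincomb y r) t))%:M = adj (h (lincomb y r) t)%:M :> 'M_1.
  by apply/matrixP=> i j; rewrite !ord1 !mxE.
by rewrite polar_lincombl adjM adjK -!mulmxA mul_vu_mx mulmx1.
Qed.

Lemma pairingZ t a : H (t ∙ a) = H t *m a%:M.
Proof.
by apply/colP=> i; rewrite col_mul_scalar !mxE sesquiZr.
Qed.

Definition reflection (t : P) : P := t - lincomb y (D *m H t).
(** The inverse of the reflection for C is the reflection for the adjoint form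
    adj C u, whose inverse is [Dt]. *)
Definition coreflection (t : P) : P := t - lincomb y (Dt *m H t).

Lemma reflection_linear : linear reflection.
Proof.
move=> a s t; rewrite /reflection pairingD mulmxDr lincombD scalerBr opprD addrACA.
congr (_ - _ + _); rewrite -/(rscale s a) pairingZ mulmxA /lincomb.
rewrite [RHS](rscale_suml _ (a : A)); apply: eq_bigr => i _.
by rewrite col_mul_scalar rscaleA.
Qed.

Lemma coadj_DC : Dt *m Ct = E.
Proof.
by rewrite mulmxA -[_ *m adj D *m _]mulmxA -adjM CD adjK -!mulmxA mul_vu_mx
  mulmx1 mulmxA mul_vu_mx mul1mx.
Qed.

Lemma coadj_CD : Ct *m Dt = adj E.
Proof. by rewrite -mulmxA [u%:M *m _]mulmxA mul_uv_mx mul1mx -adjM DC. Qed.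

Lemma coadj_ED : E *m Dt = Dt.
Proof. by rewrite -coadj_DC -mulmxA coadj_CD -mulmxA -adjM ED. Qed.

Lemma reflection_bijective : bijective reflection.
Proof.
have lincomb0 : lincomb y 0 = 0 by rewrite -(subrr (0 : 'cV[A]_n)) lincombB subrr.
have CDH t : C *m (D *m H t) = H t by rewrite mulmxA CD adjE_pairing.
have CDHt t : Ct *m (Dt *m H t) = H t by rewrite [LHS]mulmxA coadj_CD adjE_pairing.
exists coreflection => t; rewrite /reflection /coreflection -addrA -opprD -lincombD
  pairingB pairing_lincomb -[RHS]subr0 -lincomb0; congr (_ - lincomb _ _).
  rewrite mulmxBr mulmxDl CDH mulmxDr (mulmxA Dt Ct) coadj_DC (mulmxA E) ED.
  by rewrite addrA [X in _ - X]addrC subrr.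
rewrite mulmxBr mulmxDl CDHt mulmxDr (mulmxA D C) DC (mulmxA E) coadj_ED.
by rewrite addrA subrr.
Qed.

Lemma reflection_preserves_form : preserves_form reflection.
Proof.
have CDH t : C *m (D *m H t) = H t by rewrite mulmxA CD adjE_pairing.
split=> [s t|t]; rewrite /reflection; last first.
  set r := D *m H t; set g := lincomb y r.
  have hr : h g t = \sum_i \sum_j σ (r i 0) * C i j * r j 0.
    have /matrixP/(_ 0 0) := polar_lincombl r t; rewrite mxE eqxx mulr1n => ->.
    rewrite -CDH mxE; apply: eq_bigr => i _; rewrite !mxE mulr_sumr.
    by apply: eq_bigr => j _; rewrite mulrA.
  have -> : beta (t - g) (t - g) - beta t t
      = - (beta t g - σ (beta t g) * u) + (beta g g - h g t).
    rewrite !(sesquiBl beta_sesqui) !(sesquiBr beta_sesqui) /polar.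
    rewrite !opprD !opprK addrAC [beta t t - _ - _]addrAC subrr add0r -[RHS]addrA.
    by congr (_ + _); rewrite [RHS]addrC -!addrA addNr addr0 addrC.
  apply: rpredD; first by rewrite rpredN; apply: Lam_min.
  have -> : beta g g - h g t
      = \sum_i \sum_j σ (r i 0) * (beta (y i) (y j) - C i j) * r j 0.
    rewrite hr /g /lincomb (sesqui_suml beta_sesqui) -sumrB; apply: eq_bigr => i _.
    rewrite (sesqui_sumr beta_sesqui) -sumrB; apply: eq_bigr => j _.
    by rewrite (sesquiZl beta_sesqui) (sesquiZr beta_sesqui) mulrBr mulrBl mulrA.
  apply: Lam_skew_sum => [i|i j]; first exact: Lam_conj.
  have -> : beta (y i) (y j) - C i j = - (σ (beta (y j) (y i) - C j i) * u).
    apply/eqP; rewrite -addr_eq0 sigmaB mulrBl addrACA -opprD subr_eq0.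
    by apply/eqP/polarC.
  rewrite !sigmaM sigma_sigmaE mulrN mulNr -!mulrA; congr (- (_ * (_ * (_ * _)))).
  by rewrite mulvu mulr1.
apply/eqP; rewrite !(sesquiBl h_sesqui) !(sesquiBr h_sesqui).
have scalar_inj (a b : A) : a%:M = b%:M :> 'M[A]_1 -> a = b.
  by move=> /matrixP/(_ 0 0); rewrite !mxE eqxx !mulr1n.
set r := D *m H s; set q := D *m H t; apply/eqP.
have -> : h (lincomb y r) (lincomb y q)
    = h (lincomb y r) t + h s (lincomb y q).
  apply: scalar_inj; rewrite polar_lincombl pairing_lincomb raddfD /=.
  rewrite polar_lincombl polar_lincombr -[H t]CDH -[H s]CDH adjM -/r -/q.
  by rewrite mulmxDl mulmxDr !mulmxA.
by rewrite opprB [X in _ + (X - _)]addrC addrK subrK.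
Qed.

Lemma reflection_isometry : exists phi : {linear P -> P},
  [/\ bijective phi, preserves_form phi
    & forall t, phi t = t - lincomb y (D *m H t)].
Proof.
pose phi : {linear P -> P} := HB.pack reflection
  (GRing.isLinear.Build A^c P P *:%R reflection reflection_linear).
by exists phi; split=> //; [exact: reflection_bijective|exact: reflection_preserves_form].
Qed.

End Reflection.
End Forms.

(** * Moving one vector to another *)

Section Matrix2.
Variable A : pzRingType.

Definition mx2 (a b c d : A) : 'M[A]_2 :=
  \matrix_(i, j) if i == 0 then if j == 0 then a else b
                 else if j == 0 then c else d.

Lemma mul_mx2 a b c d a' b' c' d' :
  mx2 a b c d *m mx2 a' b' c' d' =
  mx2 (a * a' + b * c') (a * b' + b * d') (c * a' + d * c') (c * b' + d * d').
Proof.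
by apply/matrixP=> i j; rewrite !mxE !big_ord_recl big_ord0 !mxE /= addr0;
  case: (i == 0); case: (j == 0).
Qed.

(** A matrix [[a, e], [b, c]] of maps f A + e A -> (f A + e A)^*, with b
    invertible, has the Schur complement e - a b^-1 c with respect to b: it is
    invertible as soon as that is, in particular when c is in the radical. *)
Lemma antitriangular_inverse (e f s a b b' c k : A) :
  [/\ e * e = e, b * b' = s, b' * b = f, f * b' = b' & s * c = c] ->
  [/\ e * a = a, a * f = a, c * e = c, e * k = k & k * e = k] ->
  (e - a * b' * c) * k = e -> k * (e - a * b' * c) = e ->
  let C := mx2 a e b c in
  let D := mx2 (- (b' * c * k)) (b' + b' * c * k * a * b') k (- (k * a * b')) in
  let E := mx2 f 0 0 e in
  [/\ D *m C = E, C *m D = mx2 e 0 0 s & E *m D = D].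
Proof.
move=> [ee bb' b'b fb' sc] [ea af ce ek ke] kr kl C D E.
pose q := b' * c * k; pose r := k * a * b'.
have qE : q = b' * c * k by []; have rE : r = k * a * b' by [].
have aq : a * q = k - e by rewrite /q !mulrA -[X in _ - X]kr mulrBl ek opprB addrC subrK.
have rc : r * c = k - e by rewrite /r -[X in _ - X]kl mulrBr ke opprB addrC subrK !mulrA.
have bq : b * q = c * k by rewrite /q !mulrA bb' sc.
have rb : r * b = k * a by rewrite /r -mulrA b'b -mulrA af.
have qab' : q * a * b' = b' * c * r by rewrite /q /r !mulrA.
have fq : f * q = q by rewrite /q !mulrA fb'.
have qe : q * e = q by rewrite /q -mulrA ke.
have er : e * r = r by rewrite /r !mulrA ek.
rewrite {}/C {}/D {}/E -/q -/r; clearbody q r; split; rewrite mul_mx2; congr mx2.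
- by rewrite mulNr mulrDl b'b -mulrA b'b -mulrA af addrC addrK.
- rewrite mulNr mulrDl qab' -[_ * r * c]mulrA rc mulrBr -qE -[b' * c * e]mulrA ce.
  by rewrite [_ + (q - _)]addrC subrK qe addNr.
- by rewrite mulNr rb subrr.
- by rewrite mulNr rc ke opprB addrC subrK.
- by rewrite mulrN aq ek opprB subrK.
- by rewrite mulrDr !mulrA aq !mulrBl ea mulrN er -rE [a * b' + _]addrC subrK subrr.
- by rewrite mulrN bq addNr.
- by rewrite mulrDr bb' qab' !mulrA bb' sc mulrN addrK.
- by rewrite mul0r addr0 mulrN fq.
- by rewrite mul0r addr0 mulrDr fb' !mulrA fq.
- by rewrite mul0r add0r ek.
- by rewrite mul0r add0r mulrN er.
Qed.

End Matrix2.

Section ExtensionStep.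
Variables (A : pzRingType) (U : unitary_structure A).

Local Infix "∙" := rscale (at level 40, left associativity).
Local Notation σ := (sigma U).
Local Notation u := (uunit U).
Local Notation v := (sigma U (uunit U)).

Lemma sigma_inj : injective σ.
Proof. exact: bij_inj (sigma_bij U). Qed.

Lemma sigma_surj a : exists b, σ b = a.
Proof. by have [g _ gK] := sigma_bij U; exists (g a). Qed.

Lemma corner_sigma f e a : corner f e a <-> corner (σ e) (σ f) (σ a).
Proof.
split=> -[fa ae]; split; rewrite -?sigmaM ?fa ?ae //;
  by apply: sigma_inj; rewrite sigmaM.
Qed.

Lemma corner_unit_sigma f e a : corner_unit f e a -> corner_unit (σ e) (σ f) (σ a).
Proof.
move=> [b [cb ab ba]]; exists (σ b); split; rewrite -?sigmaM ?ab ?ba //.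
exact: (proj1 (corner_sigma _ _ _) cb).
Qed.

Lemma local_sigma e : local_idempotent e -> local_idempotent (σ e).
Proof.
move=> [ee le]; split=> [|a ca]; first by rewrite -sigmaM ee.
have [b bE] := sigma_surj a; rewrite -bE in ca *.
rewrite -sigmaB.
by case: (le b (proj2 (corner_sigma _ _ _) ca)) => /corner_unit_sigma; [left|right].
Qed.

Lemma corner_unitM (g f e a b : A) :
  corner_unit g f a -> corner_unit f e b -> corner_unit g e (a * b).
Proof.
move=> [a' [ca aa' a'a]] [b' [cb bb' b'b]]; exists (b' * a'); split.
- exact: cornerM cb ca.
- by rewrite mulrA -(mulrA a) bb'; case: ca => fa' _; rewrite -mulrA fa'.
- by rewrite mulrA -(mulrA b') a'a; case: cb => _ bf; rewrite bf.
Qed.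

Variables (P : lmodType A^c) (beta : P -> P -> A).
Hypothesis beta_sesqui : sesquiform U beta.
Local Notation h := (polar U beta).
Let h_sesqui : sesquiform U h := polar_sesquiform beta_sesqui.

Section TwoVectors.
Variables (e : A) (z w : P).
Hypotheses (ee : e * e = e) (ze : z ∙ e = z) (we : w ∙ e = w).
Hypotheses (hzw : h z z = h w w) (qzw : beta w w - beta z z \in Lam U).

Let y := z - w.

Lemma polar_difference : h y y = h y z + σ (h y z) * u.
Proof.
rewrite -polar_sym // /y !(sesquiBl h_sesqui) !(sesquiBr h_sesqui) -hzw.
by rewrite opprB addrC.
Qed.

(** This, with [polar_difference], says that the class of beta at z - w is
    represented by h (z - w) z, as soon as z and w have the same invariants. *)
Lemma Lam_difference : beta y y - h y z \in Lam U.
Proof.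
have -> : beta y y - h y z = - (beta z w - σ (beta z w) * u)
    + ((beta w w - beta z z) + (beta z z - σ (beta z z) * u)).
  rewrite (addrA (beta w w - _)) subrK /polar /y.
  rewrite !(sesquiBl beta_sesqui) !(sesquiBr beta_sesqui) sigmaB mulrBl.
  rewrite !opprD !opprK.
  rewrite [LHS](AC ((2*2)*(2*2)) ((1*5)*(3*6)*(2*8)*(4*7))) /=.
  by rewrite subrr addNr !add0r.
apply: rpredD; first by rewrite rpredN; apply: Lam_min.
by apply: rpredD => //; apply: Lam_min.
Qed.

Lemma difference_e : y ∙ e = y.
Proof. by rewrite /y rscaleDl rscaleNl ze we. Qed.

(** The reflection along y = z - w with C = c = h y z maps z to
    z - y c^-1 (h y z) = z - y = w. *)
Lemma swap_by_line : corner_unit (σ e) e (h y z) ->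
  exists phi : {linear P -> P}, [/\ bijective phi, preserves_form U beta phi,
    phi z = w & forall t, h y t = 0 -> phi t = t].
Proof.
move=> [d [cd hd dh]].
have [||||||phi [bij pres phiE]] := @reflection_isometry A U P beta beta_sesqui 1
  (fun=> y) (h y z)%:M d%:M e%:M.
- by move=> i j; rewrite !ord1 !mxE eqxx !mulr1n polar_difference.
- by move=> i; rewrite !ord1 !mxE eqxx !mulr1n Lam_difference.
- by rewrite -scalar_mxM dh.
- by rewrite -scalar_mxM hd; apply/matrixP=> i j; rewrite !ord1 !mxE.
- by rewrite -scalar_mxM; case: cd => ->.
- move=> t; apply/matrixP=> k j; rewrite !ord1 !mxE big_ord1 !mxE eqxx mulr1n.
  by rewrite -sesquiZl // difference_e.
have phiE' t : phi t = t - y ∙ (d * h y t).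
  by rewrite phiE /lincomb big_ord1 !mxE big_ord1 !mxE eqxx mulr1n.
exists phi; split=> // [|t yt].
  by rewrite phiE' dh difference_e /y opprB addrC subrK.
by rewrite phiE' yt mulr0 rscale0r subr0.
Qed.

(** With C = [[beta x x, e], [- h w x, c]], the vector (h x z, h y z) = (e, c)
    is the second column of C, so that C^-1 maps it to (0, e) and the reflection
    maps z to z - y = w.  The corners match because sigma f = e makes f A the
    dual of e A.  The entry - h w x is forced: it is the one completing
    C 0 1 = h x z to a representative of the class of beta. *)
Lemma swap_by_plane (f k m m' : A) (x : P) :
  (* The inverse of - h w x = - sigma(m) u between f A and its dual. *)
  let b' := - (v * σ m') in
  σ f = e -> x ∙ f = x -> h x z = e -> h x w = m ->
  corner e e m' -> m * m' = e -> m' * m = e ->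
  corner e e k ->
  (e - beta x x * b' * h y z) * k = e -> k * (e - beta x x * b' * h y z) = e ->
  exists phi : {linear P -> P}, [/\ bijective phi, preserves_form U beta phi,
    phi z = w & forall t, h x t = 0 -> h y t = 0 -> phi t = t].
Proof.
move=> b' sf xf hxz hxw cm' mm' m'm [ek ke] kr kl.
have hwx : h w x = σ m * u by rewrite polar_sym // hxw.
pose b := - h w x; pose a := beta x x; pose c := h y z.
have vseu : v * σ e * u = f.
  by rewrite -sf sigma_sigmaE -!mulrA mulvu mulr1 mulrA mulvu mul1r.
have ff : f * f = f by apply: sigma_inj; rewrite sigmaM sf ee.
have cc : corner (σ e) e c.
  split; first by rewrite -sesquiZl // difference_e.
  by rewrite -(sesquiZr h_sesqui) ze.
have ea : e * a = a by rewrite -{1}sf -(sesquiZl beta_sesqui) xf.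
have af : a * f = a by rewrite -(sesquiZr beta_sesqui) xf.
have fv : f * v = v * σ e by rewrite -vseu -!mulrA muluv mulr1.
have fb' : f * b' = b'.
  rewrite /b' mulrN mulrA fv -mulrA -sigmaM.
  by case: cm' => _ ->.
have bb' : b * b' = σ e.
  by rewrite /b /b' hwx mulrNN -mulrA (mulrA u) muluv mul1r -sigmaM m'm.
have b'b : b' * b = f.
  by rewrite /b /b' hwx mulrNN -mulrA (mulrA (σ m')) -sigmaM mm' mulrA.
have [||DC CD ED] := @antitriangular_inverse A e f (σ e) a b b' c k _ _ kr kl.
- by split=> //; case: cc.
- by split=> //; case: cc.
set D := mx2 (- (b' * c * k)) _ _ _ in DC CD ED.
pose y2 (i : 'I_2) := if i == 0 then x else y.
have H2 t i : pairing U beta y2 t i 0 = if i == 0 then h x t else h y t.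
  by rewrite mxE /y2; case: (i == 0).
have adjE : adj U (mx2 f 0 0 e) = mx2 e 0 0 (σ e).
  apply/matrixP=> i j; rewrite !mxE.
  by case: (i == 0); case: (j == 0); rewrite ?sigma0 ?sf.
have mul_col (p q r s : A) (X : 'cV[A]_2) i :
    (mx2 p q r s *m X) i 0 = if i == 0 then p * X 0 0 + q * X 1 0
                             else r * X 0 0 + s * X 1 0.
  rewrite mxE !big_ord_recl big_ord0 addr0 !mxE /=.
  have -> : lift ord0 ord0 = 1 :> 'I_2 by apply: val_inj.
  by case: (i == 0).
have [||||||phi [bij pres phiE]] := @reflection_isometry A U P beta beta_sesqui 2
  y2 (mx2 a e b c) D (mx2 f 0 0 e).
- move=> i j; rewrite !mxE /y2; case: (i == 0); case: (j == 0) => //=.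
  + by rewrite (sesquiBr h_sesqui) hxz /b sigmaN mulNr -polar_sym.
  + by rewrite (sesquiBl h_sesqui) /b -hxz -polar_sym // addrC.
  + exact: polar_difference.
- move=> i; rewrite !mxE /y2; case: (i == 0); first by rewrite subrr rpred0.
  exact: Lam_difference.
- exact: DC.
- by rewrite adjE.
- exact: ED.
- move=> t; apply/colP=> i; rewrite adjE mul_col !H2 /=.
  case: (i == 0); last by rewrite mul0r add0r -(sesquiZl h_sesqui) difference_e.
  by rewrite mul0r addr0 -sf -(sesquiZl h_sesqui) xf.
have lin2 r : lincomb y2 r = x ∙ r 0 0 + y ∙ r 1 0.
  rewrite /lincomb !big_ord_recl big_ord0 addr0 /y2 /=.
  by have -> : lift ord0 ord0 = 1 :> 'I_2 by apply: val_inj.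
have e01 p q r s p' q' r' s' : mx2 p q r s = mx2 p' q' r' s' :> 'M[A]_2 -> q = q' /\ s = s'.
  by move=> /matrixP H; split; [have := H 0 1|have := H 1 1]; rewrite !mxE.
exists phi; split=> // [|t xt yt].
  move: DC; rewrite mul_mx2 => /e01[DC0 DC1].
  by rewrite phiE lin2 !mul_col !H2 /= hxz DC0 DC1 rscale0r add0r difference_e
    /y opprB addrC subrK.
by rewrite phiE lin2 !mul_col !H2 /= xt yt !mulr0 !addr0 !rscale0r addr0 subr0.
Qed.

End TwoVectors.
End ExtensionStep.

(** * Isometries between families of vectors *)

Section ExtensionTheorem.
Variables (A : pzRingType) (U : unitary_structure A).
Variables (P : lmodType A^c) (beta : P -> P -> A).
Hypothesis beta_sesqui : sesquiform U beta.

Local Infix "∙" := rscale (at level 40, left associativity).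
Local Notation σ := (sigma U).
Local Notation u := (uunit U).
Local Notation v := (sigma U (uunit U)).
Local Notation h := (polar U beta).
Let h_sesqui : sesquiform U h := polar_sesquiform beta_sesqui.

(** A local substitute for the fact that a vector space is not the union of two
    proper subspaces: among x1, x2 and x1 + x2 one pairs invertibly with both z
    and w, because the sum of a unit and a nonunit is a unit. *)
Lemma common_dual_vector (e f : A) (z w x1 x2 : P) :
  local_idempotent e -> σ f = e -> z ∙ e = z -> w ∙ e = w ->
  h x1 z = e -> h x2 w = e ->
  exists x, [/\ x ∙ f = x, h x z = e, corner_unit e e (h x w)
    & forall t, h x1 t = 0 -> h x2 t = 0 -> h x t = 0].
Proof.
move=> [ee le] sf ze we h1z h2w.
suff [x0 [x0f u1 u2 x0t]] : exists x, [/\ x ∙ f = x, corner_unit e e (h x z),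
    corner_unit e e (h x w) & forall t, h x1 t = 0 -> h x2 t = 0 -> h x t = 0].
  have [b [cb zb bz]] := u1; have [s sE] := sigma_surj U b.
  have sf' : s * f = s.
    by apply: (@sigma_inj _ U); rewrite sigmaM sf sE; case: cb.
  exists (x0 ∙ s); split.
  - by rewrite rscaleA sf'.
  - by rewrite (sesquiZl h_sesqui) sE.
  - rewrite (sesquiZl h_sesqui) sE; apply: corner_unitM u2.
    exists (h x0 z); split=> //; split; last by rewrite -(sesquiZr h_sesqui) ze.
    by rewrite -{1}sf -(sesquiZl h_sesqui) x0f.
  - by move=> t t1 t2; rewrite (sesquiZl h_sesqui) x0t // mulr0.
have unit_e : corner_unit e e e by exists e.
have ff : f * f = f by apply: (@sigma_inj _ U); rewrite sigmaM sf ee.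
have fval x t : t ∙ e = t -> corner e e (h (x ∙ f) t).
  move=> te; split; first by rewrite -{1}sf -(sesquiZl h_sesqui) rscaleA ff.
  by rewrite -(sesquiZr h_sesqui) te.
have hz : h (x1 ∙ f) z = e by rewrite (sesquiZl h_sesqui) sf h1z.
have hw : h (x2 ∙ f) w = e by rewrite (sesquiZl h_sesqui) sf h2w.
have f0 x t : h x t = 0 -> h (x ∙ f) t = 0.
  by rewrite (sesquiZl h_sesqui) => ->; rewrite mulr0.
have xff x : x ∙ f ∙ f = x ∙ f by rewrite rscaleA ff.
have [/corner_unitN|] := le _ (cornerN (fval x1 w we)).
  rewrite opprK => uw; exists (x1 ∙ f); split; rewrite ?hz // => t t1 _; exact: f0.
rewrite opprK => uw.
have [/corner_unitN|] := le _ (cornerN (fval x2 z ze)).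
  rewrite opprK => uz; exists (x2 ∙ f); split; rewrite ?hw // => t _; exact: f0.
rewrite opprK => uz.
exists (x1 ∙ f + x2 ∙ f); split.
- by rewrite rscaleDl !xff.
- by rewrite (sesquiDl h_sesqui) hz.
- by rewrite (sesquiDl h_sesqui) hw addrC.
- by move=> t t1 t2; rewrite (sesquiDl h_sesqui) !f0 // addr0.
Qed.

(** The element a b' c, with b' the inverse of - h w x, decides between the two
    reflections.  If it is a unit of e A e, then c has a left inverse, hence is
    invertible, and the line suffices.  Otherwise the Schur complement
    e - a b' c is a unit, and the plane works. *)
Lemma swap_vectors (e : A) (z w x1 x2 : P) :
  local_idempotent e -> z ∙ e = z -> w ∙ e = w ->
  h z z = h w w -> beta w w - beta z z \in Lam U ->
  h x1 z = e -> h x2 w = e ->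
  exists phi : {linear P -> P}, [/\ bijective phi, preserves_form U beta phi,
    phi z = w
    & forall t, h x1 t = 0 -> h x2 t = 0 -> h (z - w) t = 0 -> phi t = t].
Proof.
move=> le_ ze we hzw qzw h1z h2w; have [ee le] := le_.
have [f sf] := sigma_surj U e.
have [x [xf hxz [m' [cm' mm' m'm]] xt]] :=
  common_dual_vector le_ sf ze we h1z h2w.
have ye := difference_e ze we.
pose b' := - (v * σ m'); pose a := beta x x; pose c := h (z - w) z.
have cc : corner (σ e) e c.
  split; first by rewrite -(sesquiZl h_sesqui) ye.
  by rewrite -(sesquiZr h_sesqui) ze.
have ca : corner e f a.
  split; first by rewrite -{1}sf -(sesquiZl beta_sesqui) xf.
  by rewrite -(sesquiZr beta_sesqui) xf.
have cb' : corner f (σ e) b'.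
  have vseu : v * σ e * u = f.
    by rewrite -sf sigma_sigmaE -!mulrA mulvu mulr1 mulrA mulvu mul1r.
  apply: cornerN; split.
    rewrite -vseu -!mulrA [u * _]mulrA muluv mul1r -sigmaM.
    by case: cm' => _ ->.
  by rewrite -mulrA -sigmaM; case: cm' => ->.
have cab' : corner e (σ e) (a * b') := cornerM ca cb'.
have [[d [cd zd dz]]|[k [ck kr kl]]] := le _ (cornerM cab' cc).
  have [|phi [bij pres phiz phit]] := swap_by_line beta_sesqui ze we hzw qzw.
    exists (d * (a * b')); split; [exact: cornerM cd cab'| |by rewrite -mulrA].
    apply: (local_left_inverse (local_sigma _ le_) _ ee cc (cornerM cd cab')).
      by move=> ->; exact: sigma0.
    by rewrite -mulrA.
  by exists phi; split=> // t _ _; apply: phit.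
have [phi [bij pres phiz phit]] :=
  swap_by_plane beta_sesqui ee ze we hzw qzw sf xf hxz erefl cm' mm' m'm ck kr kl.
by exists phi; split=> // t t1 t2 yt; apply: phit => //; apply: xt.
Qed.

Lemma preserves_form_comp (phi1 phi2 : P -> P) :
  preserves_form U beta phi1 -> preserves_form U beta phi2 ->
  preserves_form U beta (phi1 \o phi2).
Proof.
move=> [h1 q1] [h2 q2]; split=> [s t|t] /=; first by rewrite h1 h2.
rewrite -[X in X - _](subrK (beta (phi2 t) (phi2 t))) -addrA.
exact: rpredD.
Qed.

(** Induction on the number k of indices already treated.  If phi handles the
    first k of them, the next step moves phi (z k) to w k and must fix w i for
    i < k; it does, since w i = phi (z i) is orthogonal to phi (x1 k), to x2 k
    and to phi (z k) - w k. *)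
Lemma extend_families n (e : 'I_n -> A) (z w x1 x2 : 'I_n -> P) :
  (forall i, local_idempotent (e i)) ->
  (forall i, z i ∙ e i = z i) -> (forall i, w i ∙ e i = w i) ->
  (forall i j, h (z i) (z j) = h (w i) (w j)) ->
  (forall i, beta (w i) (w i) - beta (z i) (z i) \in Lam U) ->
  (forall i j, h (x1 i) (z j) = if i == j then e i else 0) ->
  (forall i j, h (x2 i) (w j) = if i == j then e i else 0) ->
  exists phi : {linear P -> P}, [/\ bijective phi, preserves_form U beta phi
    & forall i, phi (z i) = w i].
Proof.
move=> le ze we hzw qzw hx1 hx2.
suff H k : exists phi : {linear P -> P}, [/\ bijective phi,
    preserves_form U beta phi & forall i : 'I_n, (i < k)%N -> phi (z i) = w i].
  by have [phi [bij pres phiz]] := H n; exists phi; split=> // i; apply: phiz.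
elim: k => [|k [phi [bij pres phiz]]].
  exists (idfun : {linear P -> P}); split=> //; first by exists id.
  by split=> // t; rewrite subrr rpred0.
have [kn|nk] := ltnP k n; last first.
  by exists phi; split=> // i _; apply: phiz; apply: leq_trans nk.
pose K := Ordinal kn; have [ph pq] := pres.
have [|||||||psi [bij' pres' psiz psit]] :=
  @swap_vectors (e K) (phi (z K)) (w K) (phi (x1 K)) (x2 K).
- exact: le.
- by rewrite /rscale -linearZ_LR -/(rscale (z K) (e K)) ze.
- exact: we.
- by rewrite ph hzw.
- by rewrite -[X in X - _](subrK (beta (z K) (z K))) -addrA rpredD // -opprB rpredN.
- by rewrite ph hx1 eqxx.
- by rewrite hx2 eqxx.
exists (psi \o phi : {linear P -> P}); split.
- exact: bij_comp.
- exact: preserves_form_comp.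
move=> i; rewrite ltnS leq_eqVlt => /orP[/eqP ik|ik] /=.
  by have -> : i = K by apply: val_inj.
have neK : (K == i) = false by apply/negbTE/eqP => Ki; rewrite -Ki /= ltnn in ik.
rewrite phiz //; apply: psit.
- by rewrite -(phiz i) // ph hx1 neK.
- by rewrite hx2 neK.
- by rewrite (sesquiBl h_sesqui) -{1}(phiz i) // ph hzw subrr.
Qed.

End ExtensionTheorem.

(** * Dual bases of summands *)

Section DualBases.
Variables (A : pzRingType) (P : lmodType A^c).

Local Infix "∙" := rscale (at level 40, left associativity).

Lemma functional_linear (f : P -> A) :
  functional f -> exists F : {linear P -> (A^c)^o}, F =1 f.
Proof.
move=> [fD fZ].
have f_lin : linear (f : P -> (A^c)^o).
  by move=> a s t; rewrite fD; congr (_ + _); apply: fZ.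
pose F : {linear P -> (A^c)^o} := HB.pack (f : P -> (A^c)^o)
  (GRing.isLinear.Build A^c P (A^c)^o *:%R (f : P -> (A^c)^o) f_lin).
by exists F.
Qed.

Lemma summand_projection (Q : submodClosed P) : is_summand Q ->
  exists pi : {linear P -> P},
    (forall t, pi t \in Q) /\ (forall t, t \in Q -> pi t = t).
Proof.
move=> [T [QT disj]].
have /choice[pi piP] : forall t, exists q, q \in Q /\ t - q \in T.
  move=> t; have [q Qq [s Ts ->]] := QT t.
  by exists q; rewrite addrAC subrr add0r.
have uniq t q : q \in Q -> t - q \in T -> pi t = q.
  move=> Qq Tq; have [Qp Tp] := piP t; apply/eqP; rewrite -subr_eq0; apply/eqP.
  apply: disj; first exact: submodB.
  have -> : pi t - q = (t - q) - (t - pi t) by rewrite opprB [RHS]addrC addrA subrK.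
  exact: submodB.
have pi_lin : linear pi.
  move=> a s t; have [Qs Ts] := piP s; have [Qt Tt] := piP t.
  apply: uniq; first by apply: rpredD => //; apply: rpredZ.
  rewrite opprD addrACA -scalerBr; apply: rpredD => //; exact: rpredZ.
pose F : {linear P -> P} := HB.pack pi (GRing.isLinear.Build A^c P P *:%R pi pi_lin).
exists F; split=> t; first by case: (piP t).
by move=> Qt; apply: uniq => //; rewrite subrr rpred0.
Qed.

Lemma projective_dual_basis : finitely_generated P -> projective P ->
  exists n (x : 'I_n -> P) (f : 'I_n -> P -> A),
    (forall i, functional (f i)) /\ forall t, t = \sum_i x i ∙ f i t.
Proof.
move=> [n [g gen]] proj.
pose p0 (r : 'rV[A^c]_n) : P := \sum_i r 0 i *: g i.
have p0_lin : linear p0.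
  move=> a r s; rewrite /p0 scaler_sumr -big_split; apply: eq_bigr => i _.
  by rewrite !mxE scalerDl scalerA.
pose p : {linear 'rV[A^c]_n -> P} := HB.pack p0
  (GRing.isLinear.Build A^c 'rV[A^c]_n P *:%R p0 p0_lin).
have [|s ps] := proj _ _ p (idfun : {linear P -> P}).
  move=> t; have [a ->] := gen t; exists (\row_i a i).
  by apply: eq_bigr => i _; rewrite mxE.
exists n, g, (fun i t => s t 0 i); split=> [i|t].
  split=> [t t'|t a]; first by rewrite linearD mxE.
  by rewrite /rscale linearZ mxE.
by rewrite -[LHS]ps.
Qed.

Lemma semiperfect_dual_basis :
  semiperfect A -> finitely_generated P -> projective P ->
  exists N (e : 'I_N -> A) (x : 'I_N -> P) (f : 'I_N -> P -> A),
    dual_family e x f /\ forall t, t = \sum_i x i ∙ f i t.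
Proof.
move=> /semiperfect_local_unit[m [a [e [b [le oneE]]]]] fg proj.
have [n [x [f [ff tE]]]] := projective_dual_basis fg proj.
pose I : finType := ('I_n * 'I_m)%type.
pose E (p : I) := e p.2; pose X (p : I) := x p.1 ∙ (a p.2 * e p.2).
pose F (p : I) t := e p.2 * b p.2 * f p.1 t.
exists #|I|, (fun i => E (enum_val i)), (fun i => X (enum_val i)),
  (fun i => F (enum_val i)); split=> [i|t].
  move: (enum_val i) => -[j k]; have [ee _] := le k; have [fD fZ] := ff j.
  rewrite /E /X /F /=; split=> // [||t].
  - by rewrite rscaleA -mulrA ee.
  - by split=> [s t|t c]; rewrite ?fD ?fZ ?mulrDr ?mulrA.
  - by rewrite !mulrA ee.
rewrite -(@big_enum_val _ _ _ _ predT (fun p => X p ∙ F p t)) /=.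
rewrite -(pair_bigA _ (fun j k => X (j, k) ∙ F (j, k) t)) /= {1}[t]tE.
apply: eq_bigr => j _; rewrite -[f j t in LHS]mul1r oneE mulr_suml rscale_sumr.
apply: eq_bigr => k _; have [ee _] := le k.
by rewrite /X /F rscaleA /= !mulrA -[a k * e k * e k]mulrA ee.
Qed.

Lemma summand_orthogonal_basis (pi : {linear P -> P}) :
  semiperfect A -> finitely_generated P -> projective P ->
  (forall t, pi (pi t) = pi t) ->
  exists n (e : 'I_n -> A) (z : 'I_n -> P) (g : 'I_n -> P -> A),
    [/\ dual_family e z g, orthogonal_family e z g
      & forall t, pi t = \sum_i z i ∙ g i t].
Proof.
move=> sp fg proj pipi.
have [N [e [x [f [dual tE]]]]] := semiperfect_dual_basis sp fg proj.
have piZ t a : pi (t ∙ a) = pi t ∙ a by exact: linearZ_LR.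
apply: (@orthogonal_dual_basis _ _ N e (fun i => pi (x i)) (fun i t => f i (pi t))).
- move=> i; have [le xe [fD fZ] ef] := dual i.
  split=> // [|]; first by rewrite -piZ xe.
  by split=> [s t|t a]; rewrite ?piZ ?linearD ?fD ?fZ.
- move=> t; rewrite -pipi {1}[pi t]tE linear_sum.
  by apply: eq_bigr => i _; rewrite piZ pipi.
- by move=> i; apply: pipi.
- by move=> i t; rewrite pipi.
Qed.

End DualBases.

Lemma same_class_invariants (A : pzRingType) (U : unitary_structure A)
    (P P' : lmodType A^c) (beta : P -> P -> A) (beta' : P' -> P' -> A)
    (psi : P -> P') :
  same_class U (fun x y => beta' (psi x) (psi y)) beta ->
  (forall s t, polar U beta' (psi s) (psi t) = polar U beta s t)
  /\ forall t, beta' (psi t) (psi t) - beta t t \in Lam U.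
Proof.
case=> _ Hs Hd; split=> // s t.
have /eqP := Hs s t; rewrite -addr_eq0 sigmaB mulrBl addrACA -opprD subr_eq0.
by move/eqP.
Qed.

(** * The extension theorem *)

Theorem corollary4p9 (A : pzRingType) (U : unitary_structure A)
    (hA : semiperfect A)
    (P : lmodType A^c) (beta : P -> P -> A)
    (hP : quadratic_space U beta)
    (Q S : submodClosed P) (hQ : is_summand Q) (hS : is_summand S)
    (huni : unimodular U beta \/ unimodular U (restr beta Q))
    (psi : {linear submod_of Q -> submod_of S})
    (hpsi : qisometry U (restr beta Q) (restr beta S) psi) :
  exists phi : {linear P -> P},
    qisometry U beta beta phi
    /\ forall x : submod_of Q, phi (\val x) = \val (psi x).
Proof.
have [fg proj sesq] := hP; have [psi_bij /same_class_invariants[hpsi_h hpsi_q]] := hpsi.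
have [pi [piQ piid]] := summand_projection hQ.
have pipi t : pi (pi t) = pi t by apply: piid.
have [n [e [z [g [dual orth piE]]]]] := summand_orthogonal_basis hA fg proj pipi.
have [piz gpi] := orthogonal_fix dual orth piE.
have zQ i : z i \in Q by rewrite -piz.
pose zQ' i : submod_of Q := Sub (z i) (zQ i).
have zE i : \val (zQ' i) = z i by rewrite SubK.
have valZ i a : \val (rscale (zQ' i) a) = rscale (z i) a.
  by rewrite -zE; apply: linearZ_LR.
pose w i : P := \val (psi (zQ' i)).
have zQ'e i : rscale (zQ' i) (e i) = zQ' i.
  by apply: val_inj; rewrite valZ; case: (dual i).
have we i : rscale (w i) (e i) = w i.
  by rewrite /rscale /w -!linearZ_LR -/(rscale (zQ' i) (e i)) zQ'e.
have g_fun i : functional (g i) by case: (dual i).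
(* The dual vectors: the coordinates g i on Q, and their transports g i o psi^-1
   to S, extend to functionals on P, which are represented if P is unimodular;
   if Q is unimodular, g i is represented in Q and psi carries it to S. *)
have [x1 [x2 [hx1 hx2]]] : exists x1 x2 : 'I_n -> P,
    (forall i j, polar U beta (x1 i) (z j) = if i == j then e i else 0)
    /\ (forall i j, polar U beta (x2 i) (w j) = if i == j then e i else 0).
  case: huni => [[_ surj]|[_ surj]].
    have [piS [piSS piSid]] := summand_projection hS.
    have [psi' psiK psi'K] := psi_bij.
    pose toS t : submod_of S := Sub (piS t) (piSS t).
    pose gS i t := g i (\val (psi' (toS t))).
    have gS_fun i : functional (gS i).
      have [gD gZ] := g_fun i; split=> [s t|t a]; rewrite /gS.
        rewrite -gD -raddfD; congr (g i (val _)); apply: (bij_inj psi_bij).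
        by rewrite linearD !psi'K; apply: val_inj; rewrite raddfD !SubK linearD.
      rewrite -gZ /rscale -linearZ_LR; congr (g i (val _)); apply: (bij_inj psi_bij).
      by rewrite linearZ_LR !psi'K; apply: val_inj; rewrite linearZ_LR !SubK linearZ_LR.
    have gSw i j : gS i (w j) = g i (z j).
      rewrite /gS; congr g; rewrite -zE -[in RHS](psiK (zQ' j)); congr (val (psi' _)).
      by apply: val_inj; rewrite SubK piSid //; apply: valP.
    have /choice[x1 hx1] : forall i, exists x, polar U beta x =1 g i.
      move=> i; have [F FE] := functional_linear (g_fun i); have [x xF] := surj F.
      by exists x => t; rewrite xF FE.
    have /choice[x2 hx2] : forall i, exists x, polar U beta x =1 gS i.
      move=> i; have [F FE] := functional_linear (gS_fun i); have [x xF] := surj F.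
      by exists x => t; rewrite xF FE.
    by exists x1, x2; split=> i j; rewrite ?hx1 ?hx2 ?gSw orth.
  have gQ_fun i : functional (fun t : submod_of Q => g i (\val t)).
    have [gD gZ] := g_fun i; split=> [s t|t a]; first by rewrite raddfD gD.
    by rewrite -gZ /rscale linearZ_LR.
  have /choice[x hx] : forall i,
      exists x, polar U (restr beta Q) x =1 (fun t => g i (\val t)).
    move=> i; have [F FE] := functional_linear (gQ_fun i); have [x xF] := surj F.
    by exists x => t; rewrite xF FE.
  exists (fun i => \val (x i)), (fun i => \val (psi (x i))).
  have hxz i j : polar U (restr beta Q) (x i) (zQ' j) = if i == j then e i else 0.
    by rewrite hx zE orth.
  split=> i j; first by rewrite -hxz -zE.
  by rewrite -hxz -hpsi_h.
have [phi [phi_bij phi_pres phiz]] : exists phi : {linear P -> P},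
    [/\ bijective phi, preserves_form U beta phi & forall i, phi (z i) = w i].
  apply: (@extend_families _ U _ _ sesq n e z w x1 x2) => //.
  - by move=> i; case: (dual i).
  - by move=> i; case: (dual i).
  - by move=> i j; rewrite -!zE; exact: (esym (hpsi_h _ _)).
  - by move=> i; rewrite -zE; exact: (hpsi_q (zQ' i)).
exists phi; split; first exact: preserves_form_qisometry.
move=> x.
have xE : x = \sum_i rscale (zQ' i) (g i (\val x)).
  apply: val_inj; rewrite -[LHS]piid ?piE; last exact: valP.
  by rewrite linear_sum; apply: eq_bigr => i _; rewrite -valZ.
rewrite [in RHS]xE -[X in phi X]piid ?piE; last exact: valP.
rewrite !linear_sum; apply: eq_bigr => i _.
by rewrite /rscale !linearZ_LR phiz.
Qed.
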